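(* Let $$F(x,y,z,v,q;t)=\sum_{n=0}^\infty t^n\sum_{\sigma\in S_n} x^{\mathrm{arec}(\sigma)}\,y^{\mathrm{erec}(\sigma)}\,z^{\mathrm{rar}(\sigma)}\,v^{\mathrm{exc}(\sigma)}\,q^{\mathrm{inv}(\sigma)},$$ a formal power series in $t$ with coefficients in $\mathbb{Z}[x,y,z,v,q]$. Then $$F(x,y,z,v,q;t)=\frac{F(x,y,1,v,q;t)}{1+x(1-z)\,t\,F(x,y,1,v,q;t)},$$ where $$F(x,y,1,v,q;t)=\cfrac{1}{1-\cfrac{\alpha_1 t}{1-\cfrac{\alpha_2 t}{1-\cdots}}}$$ with coefficients, for $k\ge 1$, $$\alpha_{2k-1}=q^{k-1}(x+q+q^2+\cdots+q^{k-1}),\qquad \alpha_{2k}=q^{k}v\,(y+q+q^2+\cdots+q^{k-1}).$$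
   Context: $S_n$ is the set of permutations $\sigma=\sigma(1)\cdots\sigma(n)$ of $\{1,\dots,n\}$ ($S_0$ consists of the empty permutation, contributing $1$). For $\sigma\in S_n$, an index $i$ is: an excedance if $\sigma(i)>i$; a record if $\sigma(j)<\sigma(i)$ for all $j<i$; an antirecord if $\sigma(j)>\sigma(i)$ for all $j>i$; an exclusive record if it is a record and not also an antirecord; a record-antirecord if it is both a record and an antirecord. An inversion is a pair $j<i$ with $\sigma(j)>\sigma(i)$. The numbers of excedances, antirecords, exclusive records, record-antirecords and inversions of $\sigma$ are denoted $\mathrm{exc}(\sigma)$, $\mathrm{arec}(\sigma)$, $\mathrm{erec}(\sigma)$, $\mathrm{rar}(\sigma)$, $\mathrm{inv}(\sigma)$, respectively. For $k=1$ the sums $q+q^2+\cdots+q^{k-1}$ are empty, so $\alpha_1=x$ and $\alpha_2=qvy$. The infinite continued fraction is understood as a formal power series in $t$ (limit of its finite truncations in the $t$-adic topology). *)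

(* Defs.v *)
From HB Require Import structures.
From mathcomp Require Export all_boot all_algebra perm.
From mathcomp Require Import boolp.
From mathcomp.multinomials Require Export mpoly.

Set Implicit Arguments.
Unset Strict Implicit.
Unset Printing Implicit Defensive.

Import GRing.Theory.
Local Open Scope ring_scope.

(** [FPS c] is the formal power series [\sum_n c n * t^n]. *)
Record fps (R : Type) := FPS { fcoef : nat -> R }.

Lemma fpsP (R : Type) (f g : fps R) :
  (forall n, fcoef f n = fcoef g n) <-> f = g.
Proof.
split=> [|-> //]; case: f g => [f] [g] /= fg.
by congr FPS; apply/funext.
Qed.

HB.instance Definition _ (R : Type) := gen_eqMixin (fps R).
HB.instance Definition _ (R : Type) := gen_choiceMixin (fps R).

Section FpsRing.
Variable R : comNzRingType.
Implicit Types f g h : fps R.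

Definition fps_add f g := FPS (fun n => fcoef f n + fcoef g n).
Definition fps_opp f := FPS (fun n => - fcoef f n).
Definition fpsC (c : R) : fps R := FPS (fun n => if n == 0%N then c else 0).
Definition fpsT : fps R := FPS (fun n => (n == 1%N)%:R).
Definition fps_mul f g :=
  FPS (fun n => \sum_(i < n.+1) fcoef f i * fcoef g (n - i)).

Lemma fps_addA : associative fps_add.
Proof. by move=> f g h; apply/fpsP => n /=; rewrite addrA. Qed.
Lemma fps_addC : commutative fps_add.
Proof. by move=> f g; apply/fpsP => n /=; rewrite addrC. Qed.
Lemma fps_add0 : left_id (fpsC 0) fps_add.
Proof. by move=> f; apply/fpsP => n /=; case: eqP; rewrite add0r. Qed.
Lemma fps_addN : left_inverse (fpsC 0) fps_opp fps_add.
Proof. by move=> f; apply/fpsP => n /=; rewrite addNr; case: eqP. Qed.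

HB.instance Definition _ :=
  GRing.isZmodule.Build (fps R) fps_addA fps_addC fps_add0 fps_addN.

Definition fps_trunc n f : {poly R} := \poly_(i < n) fcoef f i.

Lemma coef_fps_trunc n f i : (i < n)%N -> (fps_trunc n f)`_i = fcoef f i.
Proof. by move=> lt_in; rewrite coef_poly lt_in. Qed.

Lemma coef_fps_mul n f g i : (i < n)%N ->
  fcoef (fps_mul f g) i = (fps_trunc n f * fps_trunc n g)`_i.
Proof.
move=> lt_in; rewrite coefM; apply: eq_bigr => j _.
rewrite !coef_fps_trunc //; first exact: leq_ltn_trans (leq_subr _ _) lt_in.
by apply: leq_ltn_trans lt_in; rewrite -ltnS.
Qed.

Lemma fps_mulC : commutative fps_mul.
Proof.
by move=> f g; apply/fpsP => n; rewrite !(coef_fps_mul _ _ (ltnSn n)) mulrC.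
Qed.

Lemma fps_mulA : associative fps_mul.
Proof.
move=> f g h; apply/fpsP => n.
have aux (a b c : fps R) : fcoef (fps_mul (fps_mul a b) c) n =
    (fps_trunc n.+1 a * fps_trunc n.+1 b * fps_trunc n.+1 c)`_n.
  rewrite coefM; apply: eq_bigr => j _.
  by rewrite (coef_fps_mul a b (ltn_ord j)) (coef_fps_trunc c) // ltnS leq_subr.
by rewrite fps_mulC !aux -[in RHS]mulrA [in RHS]mulrC.
Qed.

Lemma fps_mul1 : left_id (fpsC 1) fps_mul.
Proof.
move=> f; apply/fpsP => n /=; rewrite big_ord_recl /= mul1r subn0.
by rewrite big1 ?addr0 // => i _; rewrite mul0r.
Qed.

Lemma fps_mulDl : left_distributive fps_mul fps_add.
Proof.
move=> f g h; apply/fpsP => n /=; rewrite -big_split.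
by apply: eq_bigr => i _; rewrite mulrDl.
Qed.

Lemma fps_1neq0 : fpsC 1 != 0.
Proof.
by apply/eqP => /fpsP /(_ 0%N) /= /eqP; rewrite oner_eq0.
Qed.

HB.instance Definition _ := GRing.Zmodule_isComNzRing.Build (fps R)
  fps_mulA fps_mulC fps_mul1 fps_mulDl fps_1neq0.

Lemma fcoefD f g n : fcoef (f + g) n = fcoef f n + fcoef g n.
Proof. by []. Qed.
Lemma fcoefN f n : fcoef (- f) n = - fcoef f n.
Proof. by []. Qed.
Lemma fcoef1 n : fcoef (1 : fps R) n = (n == 0%N)%:R.
Proof. by rewrite /=; case: eqP. Qed.
Lemma fcoefM f g n :
  fcoef (f * g) n = \sum_(i < n.+1) fcoef f i * fcoef g (n - i).
Proof. by []. Qed.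
Lemma fcoef_sum (I : Type) (r : seq I) (P : pred I) (F : I -> fps R) n :
  fcoef (\sum_(i <- r | P i) F i) n = \sum_(i <- r | P i) fcoef (F i) n.
Proof.
apply: (big_morph (fun f => fcoef f n)) => [f g|]; first by [].
by rewrite /=; case: eqP.
Qed.
Lemma fcoefCM c f n : fcoef (fpsC c * f) n = c * fcoef f n.
Proof.
rewrite fcoefM big_ord_recl subn0 big1 ?addr0 // => i _.
by rewrite /= mul0r.
Qed.
Lemma fcoef_expn_eq0 f k n :
  fcoef f 0 = 0 -> (n < k)%N -> fcoef (f ^+ k) n = 0.
Proof.
move=> f0; elim: k n => // k IHk n lt_nk; rewrite exprS fcoefM.
rewrite big_ord_recl f0 mul0r add0r big1 // => i _ /=.
rewrite IHk ?mulr0 //; case: n i lt_nk => [[] //|n] i lt_nk.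
by rewrite /bump leq0n add1n subSS; apply: leq_ltn_trans (leq_subr _ _) _.
Qed.

End FpsRing.

Section FpsUnitRing.
Variable R : comUnitRingType.
Implicit Types f g : fps R.

Definition fps_unit f := fcoef f 0 \is a GRing.unit.

(** With [u = 1 - f / f_0], whose constant term vanishes, the inverse is
    [f_0^-1 * (1 + u + u^2 + ...)], and [u^k] does not contribute to the
    coefficient of [t^n] when [k > n]. *)
Definition fps_inv f :=
  if fps_unit f then
    let u := 1 - fpsC (fcoef f 0)^-1 * f in
    FPS (fun n => (fcoef f 0)^-1 * fcoef (\sum_(k < n.+1) u ^+ k) n)
  else f.

Lemma fps_mulVf : {in fps_unit, left_inverse 1 fps_inv *%R}.
Proof.
move=> f fU; have Uf : fps_unit f by []; rewrite /fps_inv Uf.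
set u := 1 - _; have u0 : fcoef u 0 = 0.
  by rewrite fcoefD fcoefN fcoefCM fcoef1 mulVr // subrr.
set g := FPS _; apply/fpsP => n.
pose G := \sum_(k < n.+1) u ^+ k.
have gE i : (i < n.+1)%N -> fcoef g i = (fcoef f 0)^-1 * fcoef G i.
  move=> lt_in; rewrite /= /G !fcoef_sum; congr (_ * _).
  rewrite -(subnKC lt_in) big_split_ord /= [X in _ + X]big1 ?addr0 // => k _.
  by apply: fcoef_expn_eq0; rewrite //= leq_addr.
have -> : fcoef (g * f) n = fcoef (G * (1 - u)) n.
  rewrite subKr mulrCA fcoefCM !fcoefM mulr_sumr.
  by apply: eq_bigr => i _; rewrite gE // mulrA.
rewrite mulrC -opprB mulNr -subrX1 opprB fcoefD fcoefN.
by rewrite (fcoef_expn_eq0 u0) ?subr0.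
Qed.

Lemma fps_unitPl f g : g * f = 1 -> fps_unit f.
Proof.
move=> /fpsP /(_ 0%N); rewrite fcoefM big_ord1 subn0 fcoef1 /= => gf1.
by apply/unitrP; exists (fcoef g 0); split=> //; rewrite mulrC.
Qed.

Lemma fps_inv_out : {in [predC fps_unit], fps_inv =1 id}.
Proof. move=> f nUf; have /negPf nUf' : ~~ fps_unit f by [].
by rewrite /fps_inv nUf'.
Qed.

HB.instance Definition _ := GRing.ComNzRing_hasMulInverse.Build (fps R)
  fps_mulVf fps_unitPl fps_inv_out.

Lemma fps_unitE f : (f \is a GRing.unit) = (fcoef f 0 \is a GRing.unit).
Proof. by []. Qed.

(** The denominators used below are invertible. *)
Lemma fps_unit_1DT (c : R) f : 1 + fpsC c * fpsT R * f \is a GRing.unit.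
Proof.
rewrite fps_unitE -mulrA fcoefD fcoefCM fcoefM big_ord1 fcoef1.
by rewrite /= mul0r mulr0 addr0 unitr1.
Qed.

Lemma fps_unit_1BT (c : R) f : 1 - fpsC c * fpsT R * f \is a GRing.unit.
Proof. by rewrite -mulrN fps_unit_1DT. Qed.

End FpsUnitRing.

(** Convergence in the [t]-adic topology: every coefficient is eventually
    equal to that of the limit. *)
Definition tadic_cvg (R : Type) (u : nat -> fps R) (l : fps R) : Prop :=
  forall m : nat, exists N : nat, forall n : nat, (N <= n)%N ->
    forall i : nat, (i < m)%N -> fcoef (u n) i = fcoef l i.

(** [sfrac a k n] is the finite continued fraction
    [1 / (1 - a_k t / (1 - a_(k+1) t / ( ... / (1 - a_(k+n-1) t))))]. *)
Fixpoint sfrac (R : comUnitRingType) (a : nat -> R) (k n : nat) : fps R :=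
  if n is n'.+1 then 1 / (1 - fpsC (a k) * fpsT R * sfrac a k.+1 n') else 1.

(** Positions and values are both shifted from [1, ..., n] to [0, ..., n-1],
    which changes none of the comparisons below. *)
Section Statistics.
Variables (n : nat) (s : 'S_n).

Definition excedance (i : 'I_n) : bool := (i < s i)%N.
Definition record (i : 'I_n) : bool :=
  [forall j : 'I_n, (j < i)%N ==> (s j < s i)%N].
Definition antirecord (i : 'I_n) : bool :=
  [forall j : 'I_n, (i < j)%N ==> (s i < s j)%N].

Definition exc : nat := #|[set i : 'I_n | excedance i]|.
Definition arec : nat := #|[set i : 'I_n | antirecord i]|.
Definition erec : nat := #|[set i : 'I_n | record i && ~~ antirecord i]|.
Definition rar : nat := #|[set i : 'I_n | record i && antirecord i]|.
Definition inv : nat :=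
  #|[set p : 'I_n * 'I_n | (p.1 < p.2)%N && (s p.2 < s p.1)%N]|.

End Statistics.

Definition Fser (R : comNzRingType) (x y z v q : R) : fps R :=
  FPS (fun n => \sum_(s : 'S_n)
    x ^+ arec s * y ^+ erec s * z ^+ rar s * v ^+ exc s * q ^+ inv s).

(** For [m = 2k-1] and for [m = 2k], [uphalf m = k]. *)
Definition alpha (R : comNzRingType) (x y v q : R) (m : nat) : R :=
  let k := uphalf m in
  if odd m then q ^+ k.-1 * (x + \sum_(1 <= j < k) q ^+ j)
  else q ^+ k * v * (y + \sum_(1 <= j < k) q ^+ j).

Lemma alpha_odd (R : comNzRingType) (x y v q : R) (k : nat) : (1 <= k)%N ->
  alpha x y v q (2 * k - 1) =
    q ^+ (k - 1) * (x + \sum_(1 <= j < k) q ^+ j).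
Proof.
case: k => // k _; have -> : (2 * k.+1 - 1 = k.*2.+1)%N.
  by rewrite mul2n doubleS subn1.
by rewrite /alpha /= odd_double doubleK subn1.
Qed.

Lemma alpha_even (R : comNzRingType) (x y v q : R) (k : nat) : (1 <= k)%N ->
  alpha x y v q (2 * k) = q ^+ k * v * (y + \sum_(1 <= j < k) q ^+ j).
Proof. by move=> _; rewrite /alpha mul2n odd_double uphalf_double. Qed.

(* Main.v *)
(* Read a permutation off in the order value 0, position 0, value 1, position 1,
   ..., and at each step either leave the current value (position) open or match
   it with a smaller open position (a smaller or equal open value). Recording an
   opening as a rise and a match as a fall gives a Dyck path whose falls from
   height k carry the total weight alpha_k: matching with the r-th smallest
   candidate creates r plus k./2 inversions, and r = 0 yields a record or an
   antirecord. Instead of labelled paths we use the permutations completing a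
   path that has reached height h, namely those sending the first h./2 positions
   to values >= uphalf h; deleting one matched point gives the recursion in h.
   The variable z only enters at height 0, which perturbs the initial equation
   of the continued fraction: F = S (1 + (z - 1) x t F), where S, the value of
   the fraction, is F at z = 1. *)
Require Import Defs.
From mathcomp Require Import zify ring.

Set Implicit Arguments.
Unset Strict Implicit.
Unset Printing Implicit Defensive.

Import GRing.Theory.
Local Open Scope ring_scope.

(** * Divisibility by powers of [t] and truncated fractions *)

Definition fps_order_ge (R : nzRingType) (m : nat) (f : fps R) : Prop :=
  forall i, (i < m)%N -> fcoef f i = 0.

Section SeriesOrder.
Variable R : comNzRingType.
Implicit Types f g : fps R.

Lemma fps_order_geD m f g :
  fps_order_ge m f -> fps_order_ge m g -> fps_order_ge m (f + g).
Proof. by move=> f0 g0 i lt_im; rewrite fcoefD f0 ?g0 ?addr0. Qed.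

Lemma fps_order_geMl m f g : fps_order_ge m f -> fps_order_ge m (g * f).
Proof.
move=> f0 i lt_im; rewrite fcoefM big1 // => j _.
by rewrite f0 ?mulr0 // (leq_ltn_trans (leq_subr _ _)).
Qed.

Lemma fcoefCTM c f n :
  fcoef (fpsC c * fpsT R * f) n = if n is m.+1 then c * fcoef f m else 0.
Proof.
rewrite -mulrA fcoefCM fcoefM; case: n => [|n].
  by rewrite big_ord1 /= mul0r mulr0.
rewrite !big_ord_recl /= mul0r add0r mul1r subSS subn0 big1 ?addr0 // => i _.
by rewrite mul0r.
Qed.

Lemma fps_order_ge_eq f g : (forall m, fps_order_ge m (f - g)) -> f = g.
Proof.
move=> fg0; apply/fpsP => n; apply/eqP; rewrite -subr_eq0 -fcoefN -fcoefD.
by rewrite (fg0 n.+1).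
Qed.

End SeriesOrder.

(* [G h] plays the role of the generating function of the weighted paths that
   descend from height [h] to height 0, whose first-passage decomposition is
   [G h = S_(h+1) * a_h t * S_h * ... * a_1 t * S_1 * E], where [S_k] is the
   infinite fraction starting at [a_k]. *)
Lemma sfrac_approx (R : comUnitRingType) (a : nat -> R) (E : fps R)
    (G : nat -> fps R) :
  (forall h, fps_order_ge h (G h)) ->
  G 0%N = E + G 1%N ->
  (forall h, G h.+1 = G h.+2 + fpsC (a h.+1) * fpsT R * G h) ->
  forall n h, fps_order_ge (h + n.+1)
    (G h - sfrac a h.+1 n *
             (if h is h'.+1 then fpsC (a h) * fpsT R * G h' else E)).
Proof.
move=> Gord G0 GS.
pose D h := if h is h'.+1 then fpsC (a h) * fpsT R * G h' else E.
have GD h : G h = D h + G h.+1.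
  by case: h => [|h]; [exact: G0 | rewrite GS addrC].
suff: forall n h, fps_order_ge (h + n.+1) (G h - sfrac a h.+1 n * D h) by [].
elim=> [|n IHn] h.
  rewrite addn1 mul1r [X in X - _]GD (addrC (D h)) addrK; exact: Gord.
have := IHn h.+1; rewrite addSnnS [sfrac _ _ n.+1]/=.
have := fps_unit_1BT (a h.+1) (sfrac a h.+2 n); rewrite [D h.+1]/=.
move: (sfrac a h.+2 n) (fpsC (a h.+1) * fpsT R) => s w uU.
(* Since [G h.+1 = G h - D h], the hypothesis at [h.+1], whose order is one higher, bounds
   [(1 - w * s) * G h - D h]; dividing by the unit gives the claim. *)
move/(@fps_order_geMl _ _ _ (1 - w * s)^-1).
congr fps_order_ge; apply: (mulrI uU); rewrite mulVKr // mul1r mulrBr mulVKr //.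
have -> : G h.+1 = G h - D h by rewrite (GD h) addrC addKr.
by ring.
Qed.

(** * Positions of records and antirecords *)

Lemma card_sum_bool (T : finType) (P : pred T) :
  #|[set i | P i]| = (\sum_i P i)%N.
Proof.
rewrite cardsE -sum1_card big_mkcond.
by apply: eq_bigr => i _; rewrite unfold_in; case: (P i).
Qed.

Lemma sum_ltn_ord n w : (\sum_(i < n) (i < w))%N = minn w n.
Proof.
elim: n => [|n IHn]; first by rewrite big_ord0 minn0.
by rewrite big_ord_recr /= IHn; lia.
Qed.

Lemma sum_ltn_perm n (s : 'S_n) c : (\sum_i (s i < c))%N = minn c n.
Proof. by rewrite -sum_ltn_ord [RHS](reindex_perm s). Qed.

Lemma forall_ord_lift n (p : 'I_n.+1) (P : pred 'I_n.+1) :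
  [forall i, P i] = P p && [forall i : 'I_n, P (lift p i)].
Proof.
apply/forallP/andP => [Pall | [Pp /forallP Plift] i].
  by split; [|apply/forallP => i]; exact: Pall.
by case: (unliftP p i) => [j|] ->.
Qed.

(** The [i] earlier positions carry distinct values below [s i]. *)
Lemma record_leq n (s : 'S_n) i : record s i -> (i <= s i)%N.
Proof.
move=> /forallP rec_i.
have: (\sum_(j < n) (j < i) <= \sum_j (s j < s i))%N.
  by apply: leq_sum => j _; have := rec_i j; lia.
rewrite sum_ltn_ord sum_ltn_perm.
by have := ltn_ord i; have := ltn_ord (s i); lia.
Qed.

(** The [s i] smaller values can only occur at earlier positions. *)
Lemma antirecord_geq n (s : 'S_n) i : antirecord s i -> (s i <= i)%N.
Proof.
move=> /forallP rec_i.
have: (\sum_j (s j < s i) <= \sum_(j < n) (j < i))%N.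
  apply: leq_sum => j _; have := rec_i j.
  by case: (ltngtP i j) => [||/val_inj->]; lia.
rewrite sum_ltn_ord sum_ltn_perm.
by have := ltn_ord i; have := ltn_ord (s i); lia.
Qed.

(* The threshold discounts the point (0, 0) of a permutation completing a path
   at height 1: it may come from an open value 0 older than position 0, in which
   case it is not a record-antirecord of the original permutation. *)
Definition rar_from n u (s : 'S_n) : nat :=
  #|[set i : 'I_n | (record s i && antirecord s i) && (u <= i)%N]|.

(** * Statistics after inserting the point [(p, c)] *)

Section LiftPerm.
Variables (n : nat) (p c : 'I_n.+1) (s : 'S_n).
Let t := lift_perm p c s.

Lemma exc_lift_perm :
  exc t = ((p < c) + \sum_(i < n) (bump p i < bump c (s i)))%N.
Proof.
rewrite /exc card_sum_bool (bigD1_ord p) //= /excedance /t lift_perm_id.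
by congr (_ + _)%N; apply: eq_bigr => i _; rewrite lift_perm_lift.
Qed.

Lemma record_lift_perm i :
  record t (lift p i) = record s i && ((p <= i)%N ==> (c <= s i)%N).
Proof.
rewrite /record (forall_ord_lift p) /t lift_perm_id lift_perm_lift /= andbC.
congr (_ && _); last by rewrite /bump; lia.
by apply: eq_forallb => j; rewrite lift_perm_lift /= /bump; lia.
Qed.

Lemma record_lift_perm_id :
  record t p = [forall i : 'I_n, (i < p)%N ==> (s i < c)%N].
Proof.
rewrite /record (forall_ord_lift p) ltnn /=.
by apply: eq_forallb => j; rewrite /t lift_perm_id lift_perm_lift /= /bump; lia.
Qed.

Lemma antirecord_lift_perm i :
  antirecord t (lift p i) = antirecord s i && ((i < p)%N ==> (s i < c)%N).
Proof.
rewrite /antirecord (forall_ord_lift p) /t lift_perm_id lift_perm_lift /= andbC.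
congr (_ && _); last by rewrite /bump; lia.
by apply: eq_forallb => j; rewrite lift_perm_lift /= /bump; lia.
Qed.

Lemma antirecord_lift_perm_id :
  antirecord t p = [forall i : 'I_n, (p <= i)%N ==> (c <= s i)%N].
Proof.
rewrite /antirecord (forall_ord_lift p) ltnn /=.
by apply: eq_forallb => j; rewrite /t lift_perm_id lift_perm_lift /= /bump; lia.
Qed.

Lemma arec_lift_perm :
  arec t = (antirecord t p + \sum_(i < n) antirecord t (lift p i))%N.
Proof. by rewrite /arec card_sum_bool (bigD1_ord p). Qed.

Lemma erec_lift_perm :
  erec t = ((record t p && ~~ antirecord t p) +
    \sum_(i < n) (record t (lift p i) && ~~ antirecord t (lift p i)))%N.
Proof. by rewrite /erec card_sum_bool (bigD1_ord p). Qed.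

Lemma rar_from_lift_perm u :
  rar_from u t = ((record t p && antirecord t p && (u <= p)) +
    \sum_(i < n) (record t (lift p i) && antirecord t (lift p i) &&
            (u <= bump p i)))%N.
Proof. by rewrite /rar_from card_sum_bool (bigD1_ord p). Qed.

Lemma inv_sum m (r : 'S_m) :
  inv r = (\sum_(i < m) \sum_(j < m) ((i < j) && (r j < r i)))%N.
Proof. by rewrite /inv card_sum_bool pair_bigA. Qed.

(** The added inversions pair the new point with higher points to its left and lower points to its
    right; old coordinates equal to [p] or [c] are shifted past it, whence the weak inequalities. *)
Lemma inv_lift_perm :
  inv t = (inv s + \sum_(i < n) ((i < p) && (c <= s i)) +
           \sum_(i < n) ((p <= i) && (s i < c)))%N.
Proof.
have row_p : (\sum_(j < n.+1) ((p < j) && (t j < t p)) =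
              \sum_(j < n) ((p <= j) && (s j < c)))%N.
  rewrite (bigD1_ord p) //= ltnn add0n; apply: eq_bigr => j _.
  by rewrite /t lift_perm_id lift_perm_lift /= /bump; lia.
have row_lift i : (\sum_(j < n.+1) ((lift p i < j) && (t j < t (lift p i))) =
    \sum_(j < n) ((i < j) && (s j < s i)) + ((i < p) && (c <= s i)))%N.
  rewrite (bigD1_ord p) //= addnC /t lift_perm_id lift_perm_lift /=.
  congr (_ + _)%N; last by rewrite /bump; lia.
  by apply: eq_bigr => j _; rewrite lift_perm_lift /= /bump; lia.
rewrite !inv_sum (bigD1_ord p) // row_p addnC -big_split /=.
by congr (_ + _)%N; apply: eq_bigr => i _; rewrite row_lift.
Qed.

End LiftPerm.

(** * Permutations completing a path *)

Definition prefix_geq n w u (s : 'S_n) : bool :=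
  [forall j : 'I_n, (j < w)%N ==> (u <= s j)%N].

Lemma prefix_geqP n w u (s : 'S_n) :
  reflect (forall j : 'I_n, (j < w)%N -> (u <= s j)%N) (prefix_geq w u s).
Proof. by apply: (iffP forallP) => H j; apply/implyP; exact: H. Qed.

(** The positions below [w] are disjoint from those of the values below [u]. *)
Lemma prefix_geq_addn n w u (s : 'S_n) :
  (w <= n)%N -> (u <= n)%N -> prefix_geq w u s -> (w + u <= n)%N.
Proof.
move=> le_wn le_un /prefix_geqP s_u.
have: (\sum_(j < n) ((j < w) + (s j < u)) <= \sum_(j < n) 1)%N.
  by apply: leq_sum => j _; have := s_u j; lia.
by rewrite big_split /= sum_ltn_ord sum_ltn_perm sum1_card card_ord; lia.
Qed.

Lemma fix0_antirecord n (s : 'S_n) (i : 'I_n) :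
  i = 0%N :> nat -> s i = 0%N :> nat -> antirecord s i.
Proof.
move=> i0 si0; apply/forallP => j; apply/implyP => lt_ij.
rewrite si0 lt0n -si0; apply/eqP => /val_inj/perm_inj ji.
by rewrite ji ltnn in lt_ij.
Qed.

(** * Reading position [w] and matching it with an open value [r] *)

Section RemovePosition.
Variables (n : nat) (w r : 'I_n.+1) (s : 'S_n).
Hypotheses (le_rw : (r <= w)%N) (s_w : prefix_geq w w s).
Let t := lift_perm w r s.
Let s_ge (j : 'I_n) : (j < w)%N -> (w <= s j)%N.
Proof. exact/prefix_geqP. Qed.

Lemma exc_remove_position : exc t = exc s.
Proof.
rewrite exc_lift_perm ltnNge le_rw add0n /exc card_sum_bool.
by apply: eq_bigr => i _; have := s_ge (j := i); rewrite /excedance /bump; lia.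
Qed.

(** An antirecord has [s i <= i], which excludes positions below [w]; all others end up to the right
    of the new point. *)
Lemma antirecord_remove_position i : antirecord t (lift w i) = antirecord s i.
Proof.
rewrite antirecord_lift_perm; case s_i: (antirecord s i) => //=.
by have := antirecord_geq s_i; have := s_ge (j := i); lia.
Qed.

Lemma record_remove_position i : record t (lift w i) = record s i.
Proof.
rewrite record_lift_perm; case s_i: (record s i) => //=.
by have := record_leq s_i; lia.
Qed.

(** All values below [r] sit to the right of the new point. *)
Lemma antirecord_removed_position : antirecord t w = (r == 0%N :> nat).
Proof.
rewrite antirecord_lift_perm_id; apply/forallP/eqP => [s_r|-> i].
  have := sum_ltn_perm s r; rewrite big1 => [|i _].
    by have := ltn_ord r; lia.
  by have := s_r i; have := s_ge (j := i); lia.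
by rewrite implybT.
Qed.

(** If [w > 0], position 0 carries a larger value, so a record forces [w = r = 0]. Hence the new
    point is never an exclusive record. *)
Lemma record_removed_position : record t w -> antirecord t w.
Proof.
rewrite record_lift_perm_id antirecord_removed_position => /forallP rec_w.
case: (posnP w) => [|w_gt0]; first by lia.
have lt0n : (0 < n)%N by have := ltn_ord w; lia.
have := s_ge (j := Ordinal lt0n) w_gt0.
by have := rec_w (Ordinal lt0n) => /=; lia.
Qed.

Lemma arec_remove_position : arec t = ((r == 0%N :> nat) + arec s)%N.
Proof.
rewrite (arec_lift_perm w r) antirecord_removed_position /arec card_sum_bool.
by congr (_ + _)%N; apply: eq_bigr => i _; rewrite antirecord_remove_position.
Qed.

Lemma erec_remove_position : erec t = erec s.
Proof.
rewrite (erec_lift_perm w r) /erec card_sum_bool.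
have -> : record t w && ~~ antirecord t w = false.
  by apply/andP => -[/record_removed_position ->].
apply: eq_bigr => i _.
by rewrite antirecord_remove_position record_remove_position.
Qed.

(** The raised threshold makes up for the shift of positions and leaves out the new point. *)
Lemma rar_from_remove_position : rar_from w.+1 t = rar_from w s.
Proof.
rewrite (rar_from_lift_perm w r) /rar_from card_sum_bool ltnn andbF add0n.
apply: eq_bigr => i _.
rewrite antirecord_remove_position record_remove_position.
by rewrite /bump; lia.
Qed.

(** The [w] earlier positions carry larger values, and the [r] smaller values come later. *)
Lemma inv_remove_position : inv t = (w + r + inv s)%N.
Proof.
rewrite inv_lift_perm.
have -> : (\sum_(i < n) ((i < w) && (r <= s i)) = \sum_(i < n) (i < w))%N.
  by apply: eq_bigr => i _; have := s_ge (j := i); lia.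
have -> : (\sum_(i < n) ((w <= i) && (s i < r)) = \sum_(i < n) (s i < r))%N.
  by apply: eq_bigr => i _; have := s_ge (j := i); lia.
rewrite sum_ltn_ord sum_ltn_perm; have := ltn_ord w; have := ltn_ord r; lia.
Qed.

End RemovePosition.

(** * Reading value [w] and matching it with an open position [r] *)

Section RemoveValue.
Variables (n : nat) (w r : 'I_n.+1) (s : 'S_n).
Hypotheses (lt_rw : (r < w)%N) (s_w : prefix_geq w.-1 w s).
Let t := lift_perm r w s.
Let s_ge (j : 'I_n) : (j < w.-1)%N -> (w <= s j)%N.
Proof. exact/prefix_geqP. Qed.

Lemma exc_remove_value : exc t = (exc s).+1.
Proof.
rewrite exc_lift_perm lt_rw add1n /exc card_sum_bool; congr _.+1.
by apply: eq_bigr => i _; have := s_ge (j := i); rewrite /excedance /bump; lia.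
Qed.

Lemma antirecord_remove_value i : antirecord t (lift r i) = antirecord s i.
Proof.
rewrite antirecord_lift_perm; case s_i: (antirecord s i) => //=.
by have := antirecord_geq s_i; have := s_ge (j := i); lia.
Qed.

(* Such a record is not a record of [t], but it is also an antirecord of [s],
   so that exclusive records are preserved. *)
Lemma record_remove_value_small i :
  record s i -> (s i < w)%N -> i = 0%N :> nat /\ s i = 0%N :> nat.
Proof.
move=> rec_i lt_siw; have le_i := record_leq rec_i.
have lt0n : (0 < n)%N by have := ltn_ord i; lia.
have /forallP/(_ (Ordinal lt0n)) := rec_i.
(* The bounds force [i = s i = w.-1]; were this positive, position 0 would carry a larger value, so
   that [i] would not be a record. *)
have := s_ge (j := i); have := s_ge (j := Ordinal lt0n) => /=.
by split; lia.
Qed.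

Lemma record_remove_value i :
  record t (lift r i) && ~~ antirecord s i = record s i && ~~ antirecord s i.
Proof.
rewrite record_lift_perm; case s_i: (record s i) => //=.
case: (ltnP (s i) w) => [/(record_remove_value_small s_i)[i0 si0]|].
  by rewrite fix0_antirecord // andbF.
by rewrite implybT.
Qed.

(** If [r > 0], position 0 is open and carries a larger value. *)
Lemma record_removed_value : record t r = (r == 0%N :> nat).
Proof.
rewrite record_lift_perm_id; apply/forallP/eqP => [rec_r|-> i //].
case: (posnP r) => // r_gt0.
have lt0n : (0 < n)%N by have := ltn_ord w; lia.
by have := s_ge (j := Ordinal lt0n); have := rec_r (Ordinal lt0n) => /=; lia.
Qed.

Lemma antirecord_removed_value : antirecord t r = false.
Proof. by apply/idP => /antirecord_geq; rewrite lift_perm_id; lia. Qed.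

Lemma arec_remove_value : arec t = arec s.
Proof.
rewrite (arec_lift_perm r w) antirecord_removed_value /arec card_sum_bool.
by apply: eq_bigr => i _; rewrite antirecord_remove_value.
Qed.

Lemma erec_remove_value : erec t = ((r == 0%N :> nat) + erec s)%N.
Proof.
rewrite (erec_lift_perm r w) /erec card_sum_bool.
rewrite antirecord_removed_value record_removed_value andbT.
congr (_ + _)%N; apply: eq_bigr => i _.
by rewrite antirecord_remove_value record_remove_value.
Qed.

Lemma rar_from_remove_value : rar_from w t = rar_from w s.
Proof.
rewrite (rar_from_lift_perm r w) /rar_from card_sum_bool.
rewrite antirecord_removed_value andbF add0n; apply: eq_bigr => i _.
rewrite antirecord_remove_value record_lift_perm.
case s_i: (record s i) => //=; case a_i: (antirecord s i); rewrite ?andbF //=.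
(* Only a point with [s i = i = w.-1] is shifted across the threshold, and it is no longer a record:
   the new point is to its left and higher. *)
have := record_leq s_i; have := antirecord_geq a_i; rewrite /bump; lia.
Qed.

(** The [r] earlier positions are open and carry larger values, and the [w] smaller values come
    later. *)
Lemma inv_remove_value : inv t = (w + r + inv s)%N.
Proof.
rewrite inv_lift_perm.
have -> : (\sum_(i < n) ((i < r) && (w <= s i)) = \sum_(i < n) (i < r))%N.
  by apply: eq_bigr => i _; have := s_ge (j := i); lia.
have -> : (\sum_(i < n) ((r <= i) && (s i < w)) = \sum_(i < n) (s i < w))%N.
  by apply: eq_bigr => i _; have := s_ge (j := i); lia.
rewrite sum_ltn_ord sum_ltn_perm; have := ltn_ord w; have := ltn_ord r; lia.
Qed.

End RemoveValue.

(** * Deleting a point as a bijection *)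

Lemma lift_perm_inj n (p c : 'I_n.+1) : injective (lift_perm p c).
Proof.
move=> s t eq_st; apply/permP => i; apply: (@lift_inj _ c).
by rewrite -!(lift_perm_lift p) eq_st.
Qed.

Lemma lift_perm_onto n (p c : 'I_n.+1) (s : 'S_n.+1) :
  s p = c -> exists s' : 'S_n, s = lift_perm p c s'.
Proof.
(* The default is never taken: only [p] is sent to [c]. *)
move=> sp; pose f i := odflt i (unlift c (s (lift p i))).
have fK i : lift c (f i) = s (lift p i).
  rewrite /f; have := neq_lift p i.
  by rewrite -(inj_eq (@perm_inj _ s)) sp => /unlift_some[? ? ->].
have f_inj : injective f.
  by move=> i j eq_f; apply/(@lift_inj _ p)/(@perm_inj _ s); rewrite -!fK eq_f.
exists (perm f_inj); apply/permP => i.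
by case: (unliftP p i) => [j|] ->; rewrite ?lift_perm_id ?lift_perm_lift ?permE.
Qed.

Lemma sum_lift_perm (V : nmodType) n (p c : 'I_n.+1) (P : pred 'S_n.+1)
    (F : 'S_n.+1 -> V) :
  \sum_(s | P s && (s p == c)) F s =
  \sum_(s : 'S_n | P (lift_perm p c s)) F (lift_perm p c s).
Proof.
transitivity (\sum_(s in [set lift_perm p c s | s in
                             [pred s : 'S_n | P (lift_perm p c s)]]) F s).
  apply: eq_bigl => s; apply/andP/imsetP.
    case=> Ps /eqP/lift_perm_onto[s' def_s].
    by exists s'; rewrite // inE -def_s.
  by case=> s'; rewrite inE => Ps' ->; rewrite lift_perm_id.
by rewrite big_imset //; exact: in2W (@lift_perm_inj _ _ _).
Qed.

(** * Weighted sums and their recursion in the height *)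

Section PrefixSum.
Variables (R : comNzRingType) (x y z v q : R).

Definition weight n u (s : 'S_n) : R :=
  x ^+ arec s * y ^+ erec s * z ^+ rar_from u s * v ^+ exc s * q ^+ inv s.

Definition prefix_sum n w u : R :=
  \sum_(s : 'S_n | prefix_geq w u s) weight u s.

Local Notation a := (alpha x y v q).

Lemma prefix_sum_eq0 n w u :
  (w <= n)%N -> (u <= n)%N -> (n < w + u)%N -> prefix_sum n w u = 0.
Proof.
move=> le_wn le_un lt_n; apply: big1 => s /(prefix_geq_addn le_wn le_un).
by rewrite leqNgt lt_n.
Qed.

Lemma weight_remove_position n (w r : 'I_n.+1) (s : 'S_n) :
  (r <= w)%N -> prefix_geq w w s ->
  weight w.+1 (lift_perm w r s) =
  q ^+ w * (if r == 0%N :> nat then x else q ^+ r) * weight w s.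
Proof.
move=> le_rw s_w; rewrite /weight exc_remove_position //.
rewrite arec_remove_position // erec_remove_position //.
rewrite rar_from_remove_position // inv_remove_position // !exprD.
by case: eqP => [->|_] /=; ring.
Qed.

Lemma weight_remove_value n (w r : 'I_n.+1) (s : 'S_n) :
  (r < w)%N -> prefix_geq w.-1 w s ->
  weight w (lift_perm r w s) =
  q ^+ w * v * (if r == 0%N :> nat then y else q ^+ r) * weight w s.
Proof.
move=> lt_rw s_w; rewrite /weight exc_remove_value //.
rewrite arec_remove_value // erec_remove_value //.
rewrite rar_from_remove_value // inv_remove_value // !exprD exprS.
by case: eqP => [->|_] /=; ring.
Qed.

Lemma prefix_geq_remove_position n (w r : 'I_n.+1) (s : 'S_n) :
  (r <= w)%N -> prefix_geq w w.+1 (lift_perm w r s) = prefix_geq w w s.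
Proof.
move=> le_rw; rewrite /prefix_geq (forall_ord_lift w) ltnn /=.
by apply: eq_forallb => j; rewrite lift_perm_lift /= /bump; lia.
Qed.

Lemma prefix_geq_remove_value n (w r : 'I_n.+1) (s : 'S_n) :
  (r < w)%N -> prefix_geq w w (lift_perm r w s) = prefix_geq w.-1 w s.
Proof.
move=> lt_rw; rewrite /prefix_geq (forall_ord_lift r).
rewrite lift_perm_id leqnn implybT.
by apply: eq_forallb => j; rewrite lift_perm_lift /= /bump; lia.
Qed.

Lemma sum_ord_head_expr (c : R) k m : (0 < k <= m)%N ->
  \sum_(r < m | (r < k)%N) (if r == 0%N :> nat then c else q ^+ r) =
  c + \sum_(1 <= r < k) q ^+ r.
Proof.
case/andP=> k_gt0 le_km.
pose f r := if r == 0%N then c else q ^+ r.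
rewrite -(big_ord_widen _ f le_km) -(big_mkord xpredT f).
by rewrite big_ltn //; congr (_ + _); apply: eq_big_nat => -[].
Qed.

Lemma rar_fromS n (s : 'S_n) (i : 'I_n) :
  rar_from i s = ((record s i && antirecord s i) + rar_from i.+1 s)%N.
Proof.
rewrite /rar_from !card_sum_bool (bigD1 i) // [in RHS](bigD1 i) //=.
rewrite leqnn ltnn andbT andbF add0n; congr (_ + _)%N.
apply: eq_bigr => j neq_ji; congr (nat_of_bool (_ && _)).
by rewrite ltn_neqAle eq_sym neq_ji.
Qed.

Lemma rar_fix n (s : 'S_n) i : record s i -> antirecord s i -> s i = i.
Proof.
by move=> /record_leq le_i /antirecord_geq ge_i; apply/val_inj/anti_leq/andP.
Qed.

(** Position [w] is read at height [2w + 1]: a value above [w] leaves it open (a rise), otherwise it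
    is matched with one of the [w + 1] open values (a fall). Only a fall removes a point. *)
Lemma prefix_sum_odd_step n w : (w <= n)%N ->
  prefix_sum n.+1 w w.+1 =
  prefix_sum n.+1 w.+1 w.+1 + a w.*2.+1 * prefix_sum n w w.
Proof.
move=> le_wn; pose W : 'I_n.+1 := inord w.
have W_w : W = w :> nat by rewrite inordK.
rewrite {1}/prefix_sum (bigID (fun s : 'S_n.+1 => w < s W)%N) /=; congr (_ + _).
  apply: eq_bigl => s.
  apply/andP/prefix_geqP => [[/prefix_geqP s_w lt_w] j|s_w].
    rewrite ltnS leq_eqVlt => /orP[/eqP j_w|]; last exact: s_w.
    by have -> : j = W by apply/val_inj; rewrite /= W_w.
  by split; [apply/prefix_geqP => j lt_jw|]; rewrite s_w ?W_w // leqW.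
rewrite (partition_big (fun s : 'S_n.+1 => s W) (fun r => r < w.+1)%N) /=;
  last by move=> s /andP[_]; rewrite -leqNgt.
rewrite (eq_bigr (fun r : 'I_n.+1 =>
    q ^+ w * (if r == 0%N :> nat then x else q ^+ r) * prefix_sum n w w)).
  rewrite -mulr_suml -mulr_sumr sum_ord_head_expr ?ltnS // /alpha /=.
  by rewrite odd_double /= doubleK.
move=> r le_rw; rewrite /prefix_sum mulr_sumr.
transitivity (\sum_(s : 'S_n.+1 | prefix_geq w w.+1 s && (s W == r))
                weight w.+1 s).
  apply: eq_bigl => s; case: eqP => [->|]; rewrite ?andbF //.
  by rewrite -leqNgt -ltnS le_rw !andbT.
rewrite sum_lift_perm -W_w in le_rw *.
apply: eq_big => s; first exact: prefix_geq_remove_position.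
by rewrite prefix_geq_remove_position // => s_w; exact: weight_remove_position.
Qed.

(** Value [w] is read at height [2w]: it is left open or matched with one of the [w] open
    positions. *)
Lemma prefix_sum_even_step n w : (0 < w <= n)%N ->
  prefix_sum n.+1 w w =
  prefix_sum n.+1 w w.+1 + a w.*2 * prefix_sum n w.-1 w.
Proof.
case/andP=> w_gt0 le_wn; pose W : 'I_n.+1 := inord w.
have W_w : W = w :> nat by rewrite inordK.
rewrite {1}/prefix_sum (bigID (fun s : 'S_n.+1 => w <= s^-1%g W)%N) /=.
congr (_ + _).
  apply: eq_big => s.
    apply/andP/prefix_geqP => [[/prefix_geqP s_w le_w] j lt_jw|s_w].
      rewrite ltn_neqAle s_w // andbT; apply/eqP => w_sj; move: le_w.
      have -> : W = s j by apply/val_inj; rewrite /= W_w.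
      by rewrite permK leqNgt lt_jw.
    split; first by apply/prefix_geqP => j /s_w/ltnW.
    by case: leqP => // /s_w; rewrite permKV W_w ltnn.
  (* Raising the threshold to [w.+1] loses nothing: a record-antirecord at [w] would be a fixed
     point, but position 0 already carries a value at least [w]. *)
  case/andP=> /prefix_geqP s_w le_w; rewrite /weight -[in LHS]W_w rar_fromS W_w.
  case: andP => // -[rec_W arec_W]; have sW := rar_fix rec_W arec_W.
  move/forallP/(_ ord0): rec_W; have := s_w ord0 w_gt0.
  by rewrite sW W_w w_gt0 /= leqNgt => /negPf->.
rewrite (partition_big (fun s : 'S_n.+1 => s^-1%g W) (fun r => r < w)%N) /=;
  last by move=> s /andP[_]; rewrite -ltnNge.
rewrite (eq_bigr (fun r : 'I_n.+1 =>
    q ^+ w * v * (if r == 0%N :> nat then y else q ^+ r) *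
    prefix_sum n w.-1 w)).
  rewrite -mulr_suml -mulr_sumr sum_ord_head_expr ?w_gt0 ?leqW // /alpha /=.
  by rewrite odd_double /= uphalf_double.
move=> r lt_rw; rewrite /prefix_sum mulr_sumr.
transitivity (\sum_(s : 'S_n.+1 | prefix_geq w w s && (s r == W)) weight w s).
  apply: eq_bigl => s; rewrite (canF_eq (permKV s)) eq_sym.
  by case: eqP => [<-|]; rewrite ?andbF // permK -ltnNge lt_rw !andbT.
rewrite sum_lift_perm -W_w in lt_rw *.
apply: eq_big => s; first exact: prefix_geq_remove_value.
by rewrite prefix_geq_remove_value // => s_w; exact: weight_remove_value.
Qed.

(** Both sums run over all permutations and differ only in the threshold, which costs a factor [z]
    exactly when 0 is fixed; deleting that fixed point yields [x]. *)
Lemma prefix_sum_zero_step n :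
  prefix_sum n.+1 0 0 = prefix_sum n.+1 0 1 + (z - 1) * x * prefix_sum n 0 0.
Proof.
have prefix0 m u (s : 'S_m) : prefix_geq 0 u s by apply/prefix_geqP.
have fix0 : \sum_(s : 'S_n.+1 | s ord0 == ord0) weight 1 s =
    x * prefix_sum n 0 0.
  rewrite (sum_lift_perm ord0 ord0 xpredT) /prefix_sum mulr_sumr.
  apply: eq_big => s; first by rewrite prefix0.
  by move=> _; rewrite (@weight_remove_position _ ord0 ord0) //= expr0 mul1r.
rewrite -mulrA -fix0 mulrBl mul1r addrC.
have all_perm u : prefix_sum n.+1 0 u = \sum_(s : 'S_n.+1) weight u s.
  by apply: eq_bigl => s; rewrite prefix0.
rewrite !all_perm (bigID (fun s : 'S_n.+1 => s ord0 == ord0)).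
rewrite [in RHS](bigID (fun s : 'S_n.+1 => s ord0 == ord0) xpredT) /=.
rewrite addrA addrNK mulr_sumr; congr (_ + _); apply: eq_bigr => s s0;
  rewrite /weight (rar_fromS s ord0).
  have s00 : s ord0 = 0%N :> nat by rewrite (eqP s0).
  have -> : record s ord0 by apply/forallP.
  by rewrite fix0_antirecord //= exprS; ring.
by case: andP => // -[rec_s /(rar_fix rec_s)/eqP]; rewrite (negPf s0).
Qed.

End PrefixSum.

(** * From the recursion to the continued fraction *)

Section ContinuedFraction.
Variables (R : comUnitRingType) (x y z v q : R).
Local Notation a := (alpha x y v q).
Local Notation prefix_sum := (prefix_sum x y z v q).

(** The cut-off is imposed because [prefix_geq] can hold vacuously beyond it: at [n = 0] every
    [prefix_sum] is 1. *)
Definition height_sum n h : R :=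
  if (h <= n)%N then prefix_sum n h./2 (uphalf h) else 0.

Lemma height_sumS n h :
  height_sum n.+1 h.+1 = height_sum n.+1 h.+2 + a h.+1 * height_sum n h.
Proof.
rewrite /height_sum !ltnS; case: (leqP h n) => [le_hn|lt_nh]; last first.
  by rewrite leqNgt ltnW ?mulr0 ?addr0.
(* At [h = n] the cut-off agrees with [prefix_sum], whose constraints then need [n + 2] distinct
   positions. *)
have -> : (if (h < n)%N then prefix_sum n.+1 h.+2./2 (uphalf h.+2) else 0) =
    prefix_sum n.+1 h./2.+1 (uphalf h).+1.
  case: ltnP => // le_nh; rewrite prefix_sum_eq0 //; lia.
(* For odd [h] the height [h.+1] is even and a value is read; otherwise a position is. *)
move: le_hn; rewrite -[h]odd_double_half; case: (odd h); move: h./2 => k le_kn.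
  rewrite add1n -doubleS !doubleK !uphalf_double /= uphalf_double doubleK.
  by rewrite prefix_sum_even_step //; lia.
by rewrite add0n /= doubleK uphalf_double prefix_sum_odd_step //; lia.
Qed.

Lemma height_sum0S n :
  height_sum n.+1 0 = height_sum n.+1 1 + (z - 1) * x * height_sum n 0.
Proof. exact: prefix_sum_zero_step. Qed.

Lemma height_sum00 : height_sum 0 0 = 1.
Proof.
rewrite /height_sum /= /prefix_sum (big_pred1 (1%g : 'S_0)) => [|s].
  rewrite /weight /arec /erec /rar_from /exc /inv.
  by rewrite !eq_card0 ?mulr1 // => -[[]].
transitivity true; first by apply/prefix_geqP => -[].
by apply/esym/eqP/permP => -[].
Qed.

Lemma Fser_height_sum n : fcoef (Fser x y z v q) n = height_sum n 0.
Proof.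
apply: eq_big => s; first by apply/esym/prefix_geqP.
by move=> _; rewrite /weight /rar_from; under eq_finset do rewrite andbT.
Qed.

Lemma Fser_approx n :
  let F := Fser x y z v q in
  fps_order_ge n.+1
    (F - sfrac a 1 n * (1 + fpsC ((z - 1) * x) * fpsT R * F)).
Proof.
move=> F; pose G h := FPS (height_sum^~ h).
have F_G : F = G 0%N by apply/fpsP; exact: Fser_height_sum.
(* The initial term collects the empty permutation and the correction at height 0. *)
pose E := 1 + fpsC ((z - 1) * x) * fpsT R * G 0%N.
rewrite F_G; apply: (@sfrac_approx _ a E G _ _ _ n 0%N).
- by move=> h i lt_ih; rewrite /= /height_sum leqNgt lt_ih.
- apply/fpsP => -[|m]; rewrite /E !fcoefD fcoefCTM fcoef1.
    by rewrite /= height_sum00 !addr0.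
  by rewrite add0r addrC; exact: height_sum0S.
- move=> h; apply/fpsP => -[|m]; rewrite fcoefD fcoefCTM; last first.
    exact: height_sumS.
  by rewrite addr0.
Qed.

End ContinuedFraction.

Lemma Fser1_approx (R : comUnitRingType) (x y v q : R) n :
  fps_order_ge n.+1 (Fser x y 1 v q - sfrac (alpha x y v q) 1 n).
Proof.
have := @Fser_approx R x y 1 v q n; congr fps_order_ge; congr (_ - _).
rewrite subrr mul0r -mulrA; set f := _ * Fser _ _ _ _ _.
have -> : fpsC 0 * f = 0.
  by apply/fpsP => i; rewrite fcoefCM mul0r /=; case: eqP.
by rewrite addr0 mulr1.
Qed.

Lemma Fser_rar (R : comUnitRingType) (x y z v q : R) :
  let F1 := Fser x y 1 v q in
  Fser x y z v q = F1 / (1 + fpsC (x * (1 - z)) * fpsT R * F1).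
Proof.
move=> F1; set F := Fser x y z v q; pose w := fpsC (x * (1 - z)) * fpsT R.
have F_eq : F = F1 * (1 - w * F).
  apply: fps_order_ge_eq => m; pose S := sfrac (alpha x y v q) 1 m.
  (* The truncation [S] stands in for the infinite fraction and is eliminated between the
     approximations of [F] and [F1]. *)
  have -> : F - F1 * (1 - w * F) =
      (F - S * (1 - w * F)) + (w * F - 1) * (F1 - S) by ring.
  move=> i lt_im; apply: (@fps_order_geD _ m.+1) (leqW lt_im); last first.
    by apply: fps_order_geMl; exact: Fser1_approx.
  have := @Fser_approx R x y z v q m.
  congr fps_order_ge; congr (_ - _ * (_ + _)); rewrite -!mulNr.
  congr (_ * _ * _); apply/fpsP => j /=.
  by case: eqP => _; rewrite ?oppr0 // -mulrN opprB mulrC.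
have wU := fps_unit_1DT (x * (1 - z)) F1.
by apply: (mulIr wU); rewrite mulrVK // -/w mulrDr mulr1 {1}F_eq; ring.
Qed.

Lemma Fser_sfrac_cvg (R : comUnitRingType) (x y v q : R) :
  tadic_cvg (sfrac (alpha x y v q) 1) (Fser x y 1 v q).
Proof.
move=> m; exists m => n le_mn i lt_im; apply/eqP; rewrite eq_sym -subr_eq0.
by rewrite -fcoefN -fcoefD Fser1_approx // (leq_trans lt_im) // leqW.
Qed.

Theorem theorem1p2 :
  let R : comUnitRingType := {mpoly int[5]} in
  let x : R := 'X_(inord 0) in
  let y : R := 'X_(inord 1) in
  let z : R := 'X_(inord 2) in
  let v : R := 'X_(inord 3) in
  let q : R := 'X_(inord 4) in
  let F1 : fps R := Fser x y 1 v q in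
  Fser x y z v q = F1 / (1 + fpsC (x * (1 - z)) * fpsT R * F1)
  /\ tadic_cvg (sfrac (alpha x y v q) 1) F1.
Proof.
by move=> R x y z v q F1; split; [exact: Fser_rar | exact: Fser_sfrac_cvg].
Qed.
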